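(* For $\delta\in\mathbb{R}$ let $y$ be the solution of $\ddot y+y+y^3=0$, $y(0)=\delta$, $\dot y(0)=0$. For $\gamma\in\mathbb{R}$ consider the Hill equation $$\ddot{\xi}(t)+\big(\gamma+y(t)^2\big)\xi(t)=0 .$$ Then, for every $\delta\in\mathbb{R}$, its trivial solution is stable if $-\frac{\delta^2}{2}<\gamma<1$, and it is unstable if $\gamma<-\frac{\delta^2}{2}$.
   Context: The trivial solution $\xi\equiv0$ of the linear equation $\ddot\xi+p(t)\xi=0$ is called stable if all solutions are bounded on $\mathbb{R}$, and unstable otherwise. *)

(* Defs.v *)
From Stdlib Require Import Reals.
From Coquelicot Require Import Coquelicot.
Open Scope R_scope.

(* [Derive] is total, so differentiability has to be required explicitly. *)
Definition twice_derivable (f : R -> R) : Prop :=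
  forall t : R, ex_derive f t /\ ex_derive (Derive f) t.

Definition duffing_solution (delta : R) (y : R -> R) : Prop :=
  twice_derivable y /\
  (forall t : R, Derive_n y 2 t + y t + y t ^ 3 = 0) /\
  y 0 = delta /\ Derive y 0 = 0.

Definition linear_solution (p xi : R -> R) : Prop :=
  twice_derivable xi /\
  forall t : R, Derive_n xi 2 t + p t * xi t = 0.

Definition bounded_on_R (f : R -> R) : Prop :=
  exists M : R, forall t : R, Rabs (f t) <= M.

Definition trivial_stable (p : R -> R) : Prop :=
  forall xi : R -> R, linear_solution p xi -> bounded_on_R xi.

Definition trivial_unstable (p : R -> R) : Prop := ~ trivial_stable p.

(* Main.v *)
(** The equation is a Lamé equation with n = 1, so a product of two of its
    solutions is a polynomial in [y ^ 2]: with p = gamma + y^2, the function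
    w = y^2 + 2 (1 - gamma) satisfies w''' + 4 p w' + 2 p' w = 0.  Hence
    D = w w'' / 2 - w'^2 / 4 + p w^2 is constant, and conservation of energy
    for [y] gives D = (delta^2 + 2 - 2 gamma) (delta^2 + 2 gamma) (1 - gamma).
    For gamma < 1, [w] is bounded and bounded away from 0, and D has the sign
    of delta^2 + 2 gamma.
    If D > 0, every solution xi has the first integral
    I = w xi'^2 - w' xi xi' + (w'' / 2 + p w) xi^2, and
    w I = (w xi' - w' xi / 2)^2 + D xi^2 bounds xi.
    If D < 0, then sqrt w * exp (sqrt (- D) * \int_0^t 1 / w) is an unbounded
    solution. *)
Require Import Defs.
From Stdlib Require Import Reals Lra.
From Coquelicot Require Import Coquelicot.
Open Scope R_scope.

Lemma is_derive_0_const (f : R -> R) :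
  (forall t, is_derive f t 0) -> forall s t, f s = f t.
Proof.
intros df s t.
destruct (MVT_gen f s t (fun _ => 0)) as [c [_ fc]].
- intros; apply df.
- intros x _; apply continuity_pt_filterlim, (ex_derive_continuous f).
  now exists 0.
- lra.
Qed.

Lemma twice_derivable_is_derive (f : R -> R) : twice_derivable f ->
  forall t, is_derive f t (Derive f t) /\
            is_derive (Derive f) t (Derive_n f 2 t).
Proof. intros hf t; split; apply Derive_correct; apply hf. Qed.

Lemma is_derive_twice_derivable (f f' f'' : R -> R) :
  (forall t, is_derive f t (f' t)) -> (forall t, is_derive f' t (f'' t)) ->
  twice_derivable f /\ forall t, Derive_n f 2 t = f'' t.
Proof.
intros df df'.
assert (d2 : forall t, is_derive (Derive f) t (f'' t)).
{ intros t; apply is_derive_ext with f'; [|apply df'].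
  intros s; symmetry; apply is_derive_unique, df. }
split.
- intros t; split; [exists (f' t); apply df | exists (f'' t); apply d2].
- intros t; apply is_derive_unique, d2.
Qed.

Lemma exp_linear_unbounded (a k : R) : 0 < k -> 0 < a ->
  forall M, exists t, 0 <= t /\ M < a * exp (k * t).
Proof.
intros hk ha M.
(* This [t] satisfies a k t = |M|, so exp x >= 1 + x gives a exp (k t) >= a + |M| > M. *)
exists (Rabs M / (a * k)).
assert (hM := Rabs_pos M); assert (hM' := Rle_abs M).
assert (h0 : 0 <= Rabs M / (a * k)).
{ apply Rmult_le_pos; [exact hM|].
  left; apply Rinv_0_lt_compat; nra. }
split; [exact h0|].
assert (hx := exp_ineq1_le (k * (Rabs M / (a * k)))).
assert (e : a * (k * (Rabs M / (a * k))) = Rabs M) by (field; lra).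
nra.
Qed.

Section Duffing.

Variables (delta : R) (y : R -> R) (hy : duffing_solution delta y).

Let dy (t : R) : is_derive y t (Derive y t).
Proof. apply twice_derivable_is_derive, hy. Qed.

Let d2y (t : R) : is_derive (Derive y) t (- y t - y t ^ 3).
Proof.
destruct hy as [hd [e _]].
replace (- y t - y t ^ 3) with (Derive_n y 2 t) by (specialize (e t); lra).
now apply twice_derivable_is_derive.
Qed.

(** The energy y'^2 + y^2 + y^4 / 2 has derivative 2 y' (y'' + y + y^3) = 0, and the initial data
    give its value. *)
Lemma duffing_energy (t : R) :
  Derive y t ^ 2 = delta ^ 2 + delta ^ 4 / 2 - y t ^ 2 - y t ^ 4 / 2.
Proof.
destruct hy as [_ [_ [y0 y'0]]].
assert (e : Derive y t ^ 2 + y t ^ 2 + y t ^ 4 / 2 =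
            Derive y 0 ^ 2 + y 0 ^ 2 + y 0 ^ 4 / 2).
{ apply (is_derive_0_const
    (fun t => Derive y t ^ 2 + y t ^ 2 + y t ^ 4 / 2)).
  intros s; assert (h1 := dy s); assert (h2 := d2y s).
  set (y1 := Derive y) in *.
  auto_derive.
  - repeat split; eexists; eassumption.
  - change (Derive (fun x => y x) s) with (y1 s).
    rewrite (is_derive_unique (fun x : R => y1 x) _ _ h2); field. }
rewrite y0, y'0 in e; lra.
Qed.

Lemma duffing_bounded (t : R) : y t ^ 2 <= delta ^ 2 + delta ^ 4 / 2.
Proof.
assert (e := duffing_energy t).
assert (h1 := pow2_ge_0 (Derive y t)); assert (h2 := pow2_ge_0 (y t ^ 2)).
nra.
Qed.

Variable gamma : R.

Let w (t : R) := y t ^ 2 + 2 * (1 - gamma).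
Let w' (t : R) := 2 * y t * Derive y t.
(** This is 2 y'^2 + 2 y y'' with y'' = - y - y^3 substituted, so it can be differentiated again
    using only y' and y''. *)
Let w'' (t : R) := 2 * Derive y t ^ 2 - 2 * y t ^ 2 - 2 * y t ^ 4.
Let p (t : R) := gamma + y t ^ 2.
Let D := (delta ^ 2 + 2 - 2 * gamma) * (delta ^ 2 + 2 * gamma) * (1 - gamma).

Let dw (t : R) : is_derive w t (w' t).
Proof.
unfold w, w'; assert (h1 := dy t); auto_derive.
- now exists (Derive y t).
- change (Derive (fun x => y x) t) with (Derive y t); ring.
Qed.

Let dw' (t : R) : is_derive w' t (w'' t).
Proof.
unfold w', w''; assert (h1 := dy t); assert (h2 := d2y t).
set (y1 := Derive y) in *; auto_derive.
- repeat split; eexists; eassumption.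
- change (Derive (fun x => y x) t) with (y1 t).
  rewrite (is_derive_unique (fun x : R => y1 x) _ _ h2); ring.
Qed.

(** Once the energy identity eliminates y'^2, the left side is a polynomial in y^2 whose nonconstant
    terms cancel. *)
Lemma lame_discriminant (t : R) :
  w t * w'' t / 2 - w' t ^ 2 / 4 + p t * w t ^ 2 = D.
Proof.
unfold w, w', w'', p, D.
replace ((2 * y t * Derive y t) ^ 2) with (4 * y t ^ 2 * Derive y t ^ 2)
  by ring.
rewrite duffing_energy; field.
Qed.

Lemma lame_first_integral (xi : R -> R) : linear_solution p xi ->
  exists I, forall t, w t * I =
    (w t * Derive xi t - w' t / 2 * xi t) ^ 2 + D * xi t ^ 2.
Proof.
intros [hd e].
set (I := fun t => w t * Derive xi t ^ 2 - w' t * xi t * Derive xi t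
                   + (w'' t / 2 + p t * w t) * xi t ^ 2).
(* With xi'' = - p xi, the derivative of [I] reduces to (w''' + 4 p w' + 2 p' w) xi^2 / 2, which
   vanishes. *)
assert (hI : forall t, I t = I 0).
{ intros t; apply is_derive_0_const; clear t; intros t.
  destruct (twice_derivable_is_derive xi hd t) as [h1 h2].
  assert (h3 := dy t); assert (h4 := d2y t).
  replace (Derive_n xi 2 t) with (- p t * xi t) in h2
    by (specialize (e t); lra).
  unfold I, w, w', w'', p in *.
  set (y1 := Derive y) in *; set (x1 := Derive xi) in *.
  auto_derive.
  - repeat split; eexists; eassumption.
  - change (Derive (fun x => y x) t) with (y1 t).
    change (Derive (fun x => xi x) t) with (x1 t).
    rewrite (is_derive_unique (fun x : R => y1 x) _ _ h4).
    rewrite (is_derive_unique (fun x : R => x1 x) _ _ h2); field. }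
exists (I 0); intros t.
(* Completing the square in xi' leaves exactly the discriminant as coefficient of xi^2. *)
rewrite <- (hI t), <- (lame_discriminant t); unfold I; field.
Qed.

Hypothesis gamma_lt1 : gamma < 1.

Let w_bounds : exists m M, 0 < m /\ forall t, m <= w t <= M.
Proof.
exists (2 * (1 - gamma)), (delta ^ 2 + delta ^ 4 / 2 + 2 * (1 - gamma)).
split; [lra|]; intros t; unfold w.
assert (h := duffing_bounded t); assert (h' := pow2_ge_0 (y t)); lra.
Qed.

Lemma lame_stable : - (delta ^ 2 / 2) < gamma -> trivial_stable p.
Proof.
intros hg xi hxi.
destruct (lame_first_integral xi hxi) as [I hI].
destruct w_bounds as [m [M [m0 hw]]].
assert (hD : 0 < D).
{ unfold D; assert (h := pow2_ge_0 delta).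
  repeat apply Rmult_lt_0_compat; lra. }
(* The bound on xi^2 is turned into one on |xi| by |x| <= 1 + x^2, without a square root. *)
exists (1 + M * Rabs I / D); intros t.
specialize (hI t); specialize (hw t).
assert (hI1 := Rle_abs I); assert (hI2 := Rabs_pos I).
assert (hsq := pow2_ge_0 (w t * Derive xi t - w' t / 2 * xi t)).
assert (hx : xi t ^ 2 <= M * Rabs I / D).
{ apply (Rle_div_r _ _ D hD); nra. }
assert (hx2 := pow2_abs (xi t)); assert (hx0 := Rabs_pos (xi t)).
nra.
Qed.

Lemma lame_unstable : gamma < - (delta ^ 2 / 2) -> trivial_unstable p.
Proof.
intros hg hstab.
destruct w_bounds as [m [M [m0 hw]]].
assert (wpos : forall t, 0 < w t) by (intros t; specialize (hw t); lra).
assert (hD : 0 < - D).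
{ unfold D; assert (h := pow2_ge_0 delta).
  replace (- _) with ((delta ^ 2 + 2 - 2 * gamma)
                      * (- (delta ^ 2 + 2 * gamma)) * (1 - gamma)) by ring.
  repeat apply Rmult_lt_0_compat; lra. }
set (k := sqrt (- D)).
assert (k0 : 0 < k) by now apply sqrt_lt_R0.
assert (k2 : k ^ 2 = - D) by (apply pow2_sqrt; lra).
assert (cw : forall t, continuous (fun s => / w s) t).
{ intros t; apply (ex_derive_continuous (fun s : R => / w s)).
  exists (- w' t / w t ^ 2).
  apply is_derive_inv; [apply dw | apply Rgt_not_eq, wpos]. }
set (S := fun t => RInt (fun s => / w s) 0 t).
assert (dS : forall t, is_derive S t (/ w t)).
{ intros t; apply (is_derive_RInt (fun s => / w s) S 0 t); [|apply cw].
  apply filter_forall; intros s.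
  apply (RInt_correct (fun s => / w s)), (ex_RInt_continuous (fun s => / w s)).
  intros; apply cw. }
set (xi := fun t => sqrt (w t) * exp (k * S t)).
(* [v] is the logarithmic derivative of [xi]. The Riccati equation v' = - p - v^2 then gives xi'' =
   (v' + v^2) xi = - p xi. *)
set (v := fun t => (w' t / 2 + k) / w t).
assert (dxi : forall t, is_derive xi t (v t * xi t)).
{ intros t; assert (h1 := dw t); assert (h2 := dS t); assert (h3 := wpos t).
  unfold xi, v; clearbody w S; auto_derive.
  - repeat split; try (eexists; eassumption); exact h3.
  - rewrite (is_derive_unique (fun x : R => w x) _ _ h1).
    rewrite (is_derive_unique (fun x : R => S x) _ _ h2).
    assert (h4 := sqrt_lt_R0 _ h3).
    (* Writing [w t] in the denominators as a square leaves a rational identity in [sqrt (w t)]. *)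
    rewrite <- (sqrt_sqrt (w t)) at 3 4 by lra.
    field; lra. }
assert (dv : forall t, is_derive v t (- p t - v t ^ 2)).
{ intros t; assert (h1 := dw t); assert (h2 := dw' t).
  assert (h3 := wpos t).
  (* The discriminant identity is solved for [p], with D = - k^2. *)
  assert (e : p t = (- k ^ 2 - w t * w'' t / 2 + w' t ^ 2 / 4) / w t ^ 2).
  { rewrite k2, <- (lame_discriminant t); field; lra. }
  rewrite e; unfold v; clearbody w w' w''; auto_derive.
  - repeat split; try (eexists; eassumption); lra.
  - rewrite (is_derive_unique (fun x : R => w x) _ _ h1).
    rewrite (is_derive_unique (fun x : R => w' x) _ _ h2).
    field; lra. }
assert (d2xi : forall t, is_derive (fun t => v t * xi t) t (- p t * xi t)).
{ intros t; assert (h1 := dv t); assert (h2 := dxi t).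
  clearbody v xi; auto_derive.
  - repeat split; eexists; eassumption.
  - rewrite (is_derive_unique (fun x : R => v x) _ _ h1).
    rewrite (is_derive_unique (fun x : R => xi x) _ _ h2); ring. }
destruct (is_derive_twice_derivable xi _ _ dxi d2xi) as [hd e].
destruct (hstab xi) as [B hB].
{ split; [exact hd|]; intros t; rewrite e; ring. }
assert (hM : 0 < M) by (specialize (hw 0); lra).
(* Since w <= M, the integrand is at least 1 / M; with w >= m this yields xi t >= sqrt m exp (k t /
   M) for t >= 0. *)
assert (hS : forall t, 0 <= t -> t / M <= S t).
{ intros t ht.
  replace (t / M) with (RInt (fun _ => / M) 0 t)
    by (rewrite RInt_const; unfold scal; simpl; unfold mult; simpl; field; lra).
  apply RInt_le; [exact ht | apply ex_RInt_const | |].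
  - apply (ex_RInt_continuous (fun s => / w s)); intros; apply cw.
  - intros s _; apply Rinv_le_contravar; [apply wpos | apply hw]. }
destruct (exp_linear_unbounded (sqrt m) (k / M)) with (M := B) as [t [t0 ht]].
{ now apply Rdiv_lt_0_compat. }
{ now apply sqrt_lt_R0. }
apply (Rlt_irrefl B), (Rlt_le_trans _ _ _ ht).
apply Rle_trans with (2 := hB t), Rle_trans with (2 := Rle_abs _).
apply Rmult_le_compat; [apply sqrt_pos | left; apply exp_pos | |].
- apply sqrt_le_1_alt, hw.
- replace (k / M * t) with (k * (t / M)) by (field; lra).
  assert (h : k * (t / M) <= k * S t)
    by (apply Rmult_le_compat_l; [lra | now apply hS]).
  destruct h as [h | ->]; [left; now apply exp_increasing | apply Rle_refl].
Qed.

End Duffing.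

Theorem theorem5 (delta : R) (y : R -> R) (hy : duffing_solution delta y)
    (gamma : R) :
  (- (delta ^ 2 / 2) < gamma < 1 ->
     trivial_stable (fun t => gamma + y t ^ 2)) /\
  (gamma < - (delta ^ 2 / 2) ->
     trivial_unstable (fun t => gamma + y t ^ 2)).
Proof.
split.
- intros [hg1 hg2]; now apply (lame_stable delta).
- intros hg; apply (lame_unstable delta); try assumption.
  (* Here gamma < 1 follows from gamma < - delta^2 / 2 <= 0. *)
  assert (h := pow2_ge_0 delta); lra.
Qed.
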